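(* For every integer $n \ge 1$, the polynomials $P_n$ attached to the pattern $1324$ satisfy $$P_{n}(t; X_{n},Y_{n}) = \sum_{i=1}^{n} x_{i,i}^{n-i}\, x_{i,i+1}^{n-i-1} \cdots x_{i,n-1}^{1} \cdot P_{n-1}\bigl(t;\; R_{2}(X_{n},Y_{n},i),\; R_{1}(Y_{n},i)\bigr),$$ where the monomial in front is $\prod_{j=i}^{n-1} x_{i,j}^{\,n-j}$ (empty product $=1$ when $i=n$).
   Context: $\mathcal{S}_n$ is the set of permutations $\pi=\pi_1\ldots\pi_n$ of $\{1,\ldots,n\}$. $N_{1324}(\pi)$ is the number of occurrences of the pattern $1324$ in $\pi$, i.e. the number of index quadruples $1\le a<b<c<d\le n$ with $\pi_a<\pi_c<\pi_b<\pi_d$. Let $t$, $x_{i,j}$ ($1\le i\le j\le n$) and $y_{i,j}$ ($1\le j\le i\le n$) be commuting variables. The weight of $\pi\in\mathcal{S}_n$ is $$\mathrm{weight}(\pi) := t^{N_{1324}(\pi)} \prod_{1\le i\le j\le n} x_{i,j}^{\#\{(a,b)\,:\, \pi_a<\pi_b,\ \pi_a=i,\ \pi_b>j\}} \cdot \prod_{1\le j\le i\le n} y_{i,j}^{\#\{(a,b,c)\,:\, \pi_b<\pi_a<\pi_c,\ \pi_a=i,\ \pi_b\ge j\}},$$ where always $1\le a<b<c\le n$ (respectively $1\le a<b\le n$ for pairs). $X_n=[x_{i,j}]$ and $Y_n=[y_{i,j}]$ are $n\times n$ matrices of variables; the entries of $X_n$ below the diagonal and the entries of $Y_n$ above the diagonal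 are disregarded (they play no role), and the same convention applies to all smaller matrices. Define $$P_n(t;X_n,Y_n):=\sum_{\pi\in\mathcal{S}_n}\mathrm{weight}(\pi).$$ For $n\times n$ matrices $A,B$ with entries in a commutative ring containing $t$, $P_n(t;A,B)$ denotes the result of substituting $x_{i,j}=A_{i,j}$ for $i\le j$ and $y_{i,j}=B_{i,j}$ for $j\le i$. By convention $P_0=1$ (the empty permutation has weight $1$). Operator $R_1$: for an $n\times n$ matrix $Y_n=[y_{k,l}]$ and $1\le i<n$, $R_1(Y_n,i)$ is the $(n-1)\times(n-1)$ matrix obtained by deleting the $i$-th row and replacing the $i$-th and $(i+1)$-th columns by a single column, whose entry in the row coming from row $k$ ($k\ne i$) is $t\,y_{k,i}\,y_{k,i+1}$. If $i=n$, $R_1(Y_n,n)$ is obtained by deleting the $n$-th row and $n$-th column. Operator $R_2$: for $n\times n$ matrices $X_n=[x_{k,l}]$, $Y_n=[y_{k,l}]$ and $1<i\le n$, $R_2(X_n,Y_n,i)$ is the $(n-1)\times(n-1)$ matrix obtained from $X_n$ by deleting the $i$-th row and replacing the $(i-1)$-th and $i$-th columns by a single column, whose entry in the row coming from row $k$ ($k\ne i$) is $$w_k:=\begin{cases} y_{i,1}y_{i,2}\cdots y_{i,k}\cdot x_{k,i-1}\cdot x_{k,i} & k\le i-1,\\ 0 & k>i-1.\end{cases}$$ If $i=1$, $R_2(X_n,Y_n,1)$ is obtained from $X_n$ by deleting the first row and first column. *)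

(* Defs.v *)
From HB Require Import structures.
From mathcomp Require Import all_boot all_order all_algebra all_fingroup.
From mathcomp Require Export mpoly.

Set Implicit Arguments.
Unset Strict Implicit.
Unset Printing Implicit Defensive.

Import GRing.Theory.
Local Open Scope ring_scope.

(* All indices, positions and values range over 'I_n, i.e. are shifted down
   by one with respect to {1, ..., n}. *)

Definition N1324 (n : nat) (p : 'S_n) : nat :=
  #|[set u : 'I_n * 'I_n * 'I_n * 'I_n | let: (a, b, c, d) := u in
      [&& (a < b)%N, (b < c)%N, (c < d)%N,
          (p a < p c)%N, (p c < p b)%N & (p b < p d)%N]]|.

Definition xexp (n : nat) (p : 'S_n) (i j : 'I_n) : nat :=
  #|[set u : 'I_n * 'I_n | let: (a, b) := u in
      [&& (a < b)%N, (p a < p b)%N, p a == i & (j < p b)%N]]|.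

Definition yexp (n : nat) (p : 'S_n) (i j : 'I_n) : nat :=
  #|[set u : 'I_n * 'I_n * 'I_n | let: (a, b, c) := u in
      [&& (a < b)%N, (b < c)%N, (p b < p a)%N, (p a < p c)%N,
          p a == i & (j <= p b)%N]]|.

(* The names of the variables: t, x_(i,j) and y_(i,j), in this order. The
   variables x_(i,j) with j < i and y_(i,j) with i < j exist as well, but they
   occur in no weight. *)
Definition var (n : nat) : finType := (unit + 'I_n * 'I_n + 'I_n * 'I_n)%type.

Notation polyring n := {mpoly int[#|var n|]}.

Definition tvar (n : nat) : polyring n := 'X_(enum_rank (inl (inl tt) : var n)).

Definition Xvar (n : nat) : 'M[polyring n]_n :=
  \matrix_(i, j) 'X_(enum_rank (inl (inr (i, j)) : var n)).

Definition Yvar (n : nat) : 'M[polyring n]_n :=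
  \matrix_(i, j) 'X_(enum_rank (inr (i, j) : var n)).

Definition weight (n : nat) (p : 'S_n) : polyring n :=
  tvar n ^+ N1324 p
  * (\prod_(i < n) \prod_(j < n | (i <= j)%N) Xvar n i j ^+ xexp p i j)
  * (\prod_(i < n) \prod_(j < n | (j <= i)%N) Yvar n i j ^+ yexp p i j).

Definition P (n : nat) : polyring n := \sum_(p : 'S_n) weight p.

Definition valuation (R : comNzRingType) (n : nat) (t : R) (A B : 'M[R]_n)
    (k : 'I_#|var n|) : R :=
  match enum_val k with
  | inl (inl _) => t
  | inl (inr (i, j)) => A i j
  | inr (i, j) => B i j
  end.

(* P_n(t; A, B) *)
Definition Psubst (R : comNzRingType) (n : nat) (t : R) (A B : 'M[R]_n) : R :=
  mmap intr (valuation t A B) (P n).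

(* Row r of the result comes from row [lift i r], and a column c that does not
   come from a merge comes from column [lift i c]. For c = i one has
   [lift i c] = i + 1; when i is the last index this case never occurs, and
   only the last row and column are deleted. *)
Definition R1 (R : comNzRingType) (n : nat) (t : R) (Y : 'M[R]_n.+1)
    (i : 'I_n.+1) : 'M[R]_n :=
  \matrix_(r < n, c < n)
    let k := lift i r in
    if c == i :> nat then t * Y k i * Y k (lift i c) else Y k (lift i c).

(* The merged columns i - 1 and i form the column c with c + 1 = i, for which
   [lift i c] = i - 1; when i is the first index this case never occurs, and
   only the first row and column are deleted. *)
Definition R2 (R : comNzRingType) (n : nat) (X Y : 'M[R]_n.+1)
    (i : 'I_n.+1) : 'M[R]_n :=
  \matrix_(r < n, c < n)
    let k := lift i r in
    if c.+1 == i :> nat then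
      if (k < i)%N then
        (\prod_(l < n.+1 | (l <= k)%N) Y i l) * X k (lift i c) * X k i
      else 0
    else X k (lift i c).

(* Main.v *)
Require Import Defs.
From mathcomp Require Import all_boot all_order all_algebra all_fingroup.
From mathcomp Require Import ring zify.

Set Implicit Arguments.
Unset Strict Implicit.
Unset Printing Implicit Defensive.
Import GRing.Theory.
Local Open Scope ring_scope.

(** Sort the permutations of [n + 1] values by their first entry [i]; deleting it
    and standardizing the other entries leaves a permutation [s] of [n] values,
    and the original permutation is [lift_perm ord0 i s]. It suffices to prove
    that its weight is the monomial in front times the weight of [s] evaluated at
    the matrices [R2] and [R1] ([weight_at_first]).

    What the first entry contributes is the following. As the smaller end of a
    pair it gives the monomial ([xexp_first]). As the 2 of a pattern 213 it plays
    against a 1 of value [k < i] and a 3 greater than [i], and such pairs of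
    positions are what the exponent of [x_(k,i)] counts ([yexp_first]). As the 1
    of a pattern 1324 it plays against a pattern 213 with all entries above [i],
    and these are what the exponents of the [y_(k,i)] with [k > i] count
    ([N1324_first]). Both contributions are thus determined by exponents of
    [lift_perm ord0 i s] in the rows [k <> i].

    The exponents in those rows come from the positions after the first, where
    the value [i] is absent. So two neighbouring columns have equal exponents
    there: [i - 1] and [i] for [x], [i] and [i + 1] for [y] ([xexp_merge],
    [yexp_merge]). One column holding the product of both variables therefore
    suffices to recover them, and multiplying that column by [t], respectively by
    [y_(i,1) ... y_(i,k)], accounts for the first entry ([R1_row], [R2_row],
    [Y_row_first]). *)

(** * Counting by sums, and lifted indices *)

(** Decomposing a permutation as [lift_perm ord0 i s] splits off the position
    [ord0], and sums over positions follow such a split by [big_ord_recl], which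
    cardinalities of sets of tuples do not. *)
Lemma sum_natb_card (T : finType) (Q : pred T) :
  (\sum_(u : T) (Q u : nat) = #|[set u | Q u]|)%N.
Proof.
rewrite -sum1dep_card [RHS]big_mkcond.
by apply: eq_bigr => u _; case: (Q u).
Qed.

Lemma sum_natb_pick (T : finType) (Q : pred T) (x : T) (F : T -> bool) :
  (forall k, F k -> k = x) -> (\sum_(k | Q k) F k = Q x && F x)%N.
Proof.
move=> Fx; rewrite big_mkcond (bigD1 x) //= big1 ?addn0 => [|k neq_kx].
  by case: (Q x).
by case: (Q k) => //; case Fk: (F k) => //; rewrite (Fx k Fk) eqxx in neq_kx.
Qed.

Lemma ltn_lift n (i : 'I_n.+1) (a b : 'I_n) :
  (lift i a < lift i b)%N = (a < b)%N.
Proof. by rewrite !ltnNge leq_bump2. Qed.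

Lemma leq_lift n (i : 'I_n.+1) (a b : 'I_n) :
  (lift i a <= lift i b)%N = (a <= b)%N.
Proof. exact: leq_bump2. Qed.

Lemma lift_eq n (i : 'I_n.+1) (a b : 'I_n) : (lift i a == lift i b) = (a == b).
Proof. exact: (inj_eq lift_inj). Qed.

(** * Exponents as sums over positions *)

Lemma xexpE n (p : 'S_n) i j :
  (xexp p i j = \sum_(a < n) \sum_(b < n)
     [&& (a < b)%N, (p a < p b)%N, p a == i & (j < p b)%N])%N.
Proof. by rewrite /xexp -sum_natb_card pair_bigA; apply: eq_bigr => -[]. Qed.

Lemma yexpE n (p : 'S_n) i j :
  (yexp p i j = \sum_(a < n) \sum_(b < n) \sum_(c < n)
     [&& (a < b)%N, (b < c)%N, (p b < p a)%N, (p a < p c)%N,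
         p a == i & (j <= p b)%N])%N.
Proof.
by rewrite /yexp -sum_natb_card !pair_bigA; apply: eq_bigr => -[[]].
Qed.

Lemma N1324E n (p : 'S_n) :
  (N1324 p = \sum_(a < n) \sum_(b < n) \sum_(c < n) \sum_(d < n)
     [&& (a < b)%N, (b < c)%N, (c < d)%N,
         (p a < p c)%N, (p c < p b)%N & (p b < p d)%N])%N.
Proof.
by rewrite /N1324 -sum_natb_card !pair_bigA; apply: eq_bigr => -[[[]]].
Qed.

(** Summing over the value [k] removes the constraint [p a == k], so that only
    the condition on [p a] remains. *)
Lemma sum_xexp n (p : 'S_n) (Q : pred 'I_n) j :
  (\sum_(k | Q k) xexp p k j = \sum_(a < n) \sum_(b < n)
     [&& (a < b)%N, (p a < p b)%N, Q (p a) & (j < p b)%N])%N.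
Proof.
under eq_bigr => k _ do rewrite xexpE.
rewrite exchange_big; apply: eq_bigr => a _.
rewrite exchange_big; apply: eq_bigr => b _.
rewrite (sum_natb_pick _ (x := p a)) => [|k /and4P[_ _ /eqP-> //]].
by rewrite eqxx; case: (Q _); rewrite ?andbF.
Qed.

Lemma sum_yexp n (p : 'S_n) (Q : pred 'I_n) j :
  (\sum_(k | Q k) yexp p k j = \sum_(a < n) \sum_(b < n) \sum_(c < n)
     [&& (a < b)%N, (b < c)%N, (p b < p a)%N, (p a < p c)%N,
         Q (p a) & (j <= p b)%N])%N.
Proof.
under eq_bigr => k _ do rewrite yexpE.
rewrite exchange_big; apply: eq_bigr => a _.
rewrite exchange_big; apply: eq_bigr => b _.
rewrite exchange_big; apply: eq_bigr => c _.
rewrite (sum_natb_pick _ (x := p a)) => [|k /and5P[_ _ _ _ /andP[/eqP-> //]]].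
by rewrite eqxx; case: (Q _); rewrite ?andbF.
Qed.

(** * The exponents of a permutation with a prescribed first entry *)

Section FirstEntry.
Variables (n : nat) (i : 'I_n.+1) (s : 'S_n).
Local Notation p := (lift_perm ord0 i s).
Let pE := (lift_perm_id, lift_perm_lift).

(** Every entry greater than [j >= i] stands to the right of the first entry
    [i] and exceeds it. *)
Lemma xexp_first (j : 'I_n.+1) : (i <= j)%N -> xexp p i j = (n - j)%N.
Proof.
move=> le_ij; rewrite xexpE big_ord_recl /= [X in (_ + X)%N]big1 ?addn0; last first.
  move=> a _; apply: big1 => b _; rewrite pE [lift i _ == i]eq_sym.
  by rewrite (negPf (neq_lift _ _)) /= !andbF.
under eq_bigr => b _ do rewrite pE eqxx /=.
transitivity (\sum_(v : 'I_n.+1) (j < v)%N)%N.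
  rewrite [RHS](reindex_inj (@perm_inj _ p)); apply: eq_bigr => b _.
  case: (unliftP ord0 b) => [b' ->|->]; first rewrite /=.
    congr nat_of_bool; case jlt: (j < _)%N; last by rewrite !andbF.
    by rewrite (leq_ltn_trans le_ij jlt).
  by rewrite pE ltnn /= ltnNge le_ij.
transitivity (\sum_(j.+1 <= v < n.+1) 1)%N; last first.
  by rewrite sum_nat_const_nat muln1 subSS.
by rewrite big_geq_mkord sum_natb_card sum1dep_card.
Qed.

(** The first entry takes no part in these pairs: as a left end it has the wrong
    value, and it is never a right end. *)
Lemma xexp_lift (r : 'I_n) (j : 'I_n.+1) :
  (xexp p (lift i r) j = \sum_(a < n) \sum_(b < n)
     [&& (a < b)%N, (s a < s b)%N, s a == r & (j < lift i (s b))%N])%N.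
Proof.
rewrite xexpE big_ord_recl /= [X in (X + _)%N]big1 ?add0n; last first.
  by move=> b _; rewrite pE (negPf (neq_lift _ _)) /= !andbF.
apply: eq_bigr => a _; rewrite big_ord_recl ltn0 add0n.
by apply: eq_bigr => b _; rewrite !pE lift_eq !ltn_lift.
Qed.

Lemma yexp_lift (r : 'I_n) (j : 'I_n.+1) :
  (yexp p (lift i r) j = \sum_(a < n) \sum_(b < n) \sum_(c < n)
     [&& (a < b)%N, (b < c)%N, (s b < s a)%N, (s a < s c)%N,
         s a == r & (j <= lift i (s b))%N])%N.
Proof.
rewrite yexpE big_ord_recl /= [X in (X + _)%N]big1 ?add0n; last first.
  move=> b _; apply: big1 => c _.
  by rewrite pE (negPf (neq_lift _ _)) /= !andbF.
apply: eq_bigr => a _; rewrite big_ord_recl big1 ?add0n //.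
apply: eq_bigr => b _; rewrite big_ord_recl ltn0 andbF add0n.
by apply: eq_bigr => c _; rewrite !pE lift_eq !ltn_lift.
Qed.

Lemma xexp_same (r c : 'I_n) : xexp p (lift i r) (lift i c) = xexp s r c.
Proof.
rewrite xexp_lift xexpE; apply: eq_bigr => a _; apply: eq_bigr => b _.
by rewrite ltn_lift.
Qed.

(** Reason for the merged column of [R2]: the value [i] is absent from the rest
    of the permutation, so the entries exceeding [i] are those exceeding
    [i - 1], and [s] sees the same count for both columns. *)
Lemma xexp_merge (r c : 'I_n) : c.+1 = i :> nat ->
  xexp p (lift i r) i = xexp s r c.
Proof.
move=> ci; rewrite xexp_lift xexpE.
apply: eq_bigr => a _; apply: eq_bigr => b _.
congr (nat_of_bool [&& _, _, _ & _]).
by rewrite /= /bump; case: leqP; lia.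
Qed.

Lemma yexp_same (r c : 'I_n) : yexp p (lift i r) (lift i c) = yexp s r c.
Proof.
rewrite yexp_lift yexpE; apply: eq_bigr => a _; apply: eq_bigr => b _.
by apply: eq_bigr => d _; rewrite leq_lift.
Qed.

(** Reason for the merged column of [R1]: after the first entry, at least [i] and
    at least [i + 1] mean the same, and [lift i c = i + 1] for [c = i]. *)
Lemma yexp_merge (r c : 'I_n) : c = i :> nat ->
  yexp p (lift i r) i = yexp s r c.
Proof.
move=> ci; rewrite yexp_lift yexpE.
apply: eq_bigr => a _; apply: eq_bigr => b _.
apply: eq_bigr => d _.
congr (nat_of_bool [&& _, _, _, _, _ & _]).
by rewrite /= /bump; case: leqP; lia.
Qed.

(** A pattern 213 whose 2 is the first entry [i] is a choice of a 1 of value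
    [k < i] followed by some entry greater than [i]; the latter is automatically
    greater than [k], so the choices for a given [k] number [xexp p k i]. *)
Lemma yexp_first (j : 'I_n.+1) :
  yexp p i j = (\sum_(k < n.+1 | (j <= k < i)%N) xexp p k i)%N.
Proof.
rewrite sum_xexp yexpE big_ord_recl [X in (_ + X)%N]big1 ?addn0; last first.
  move=> a _; rewrite big1 // => b _; rewrite big1 // => c _.
  by rewrite pE [lift i _ == i]eq_sym (negPf (neq_lift _ _)) /= !andbF.
rewrite [RHS]big_ord_recl [X in _ = (X + _)%N]big1 ?add0n; last first.
  by move=> b _; rewrite pE ltnn !andbF.
rewrite big_ord_recl big1 ?add0n //.
apply: eq_bigr => a _; rewrite big_ord_recl ltn0 andbF add0n.
rewrite [RHS]big_ord_recl ltn0 add0n.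
apply: eq_bigr => b _; rewrite !pE eqxx !ltn_lift ltn0Sn /=; congr nat_of_bool.
apply/and4P/and4P => [[-> lt_ai lt_ib ->]|[-> _ /andP[-> ->] ->]] //.
by rewrite lt_ai lt_ib -(ltn_lift i) (ltn_trans lt_ai lt_ib).
Qed.

(** A pattern 1324 whose 1 is the first entry [i] is a pattern 213 in the rest of
    the permutation all of whose entries exceed [i]; [k] is the value of its 2. *)
Lemma N1324_first :
  N1324 p = (N1324 s + \sum_(k < n.+1 | (i < k)%N) yexp p k i)%N.
Proof.
rewrite sum_yexp [LHS]N1324E big_ord_recl addnC; congr (_ + _)%N.
  rewrite N1324E; apply: eq_bigr => a _.
  rewrite big_ord_recl big1 ?add0n => [|c _]; last by rewrite big1.
  apply: eq_bigr => b _; rewrite big_ord_recl big1 ?add0n => [|d _]; last first.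
    by rewrite ltn0 andbF.
  apply: eq_bigr => c _; rewrite big_ord_recl ltn0 !andbF add0n.
  by apply: eq_bigr => d _; rewrite !pE !ltn_lift.
rewrite big_ord_recl big1 ?add0n => [|c _]; last by rewrite big1.
rewrite [RHS]big_ord_recl [X in _ = (X + _)%N]big1 ?add0n; last first.
  by move=> b _; rewrite big1 // => c _; rewrite pE ltnn !andbF.
apply: eq_bigr => a _.
rewrite big_ord_recl [X in (X + _)%N = _]big1 ?add0n; last first.
  by move=> d _; rewrite ltn0 andbF.
rewrite [RHS]big_ord_recl [X in _ = (X + _)%N]big1 ?add0n //.
apply: eq_bigr => b _.
rewrite big_ord_recl ltn0 !andbF add0n [RHS]big_ord_recl ltn0 andbF add0n.
apply: eq_bigr => c _; rewrite !pE !ltn_lift ltn0Sn /=; congr nat_of_bool.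
apply/and5P/and5P => [[-> -> lt_ib lt_ba ->]|[-> -> lt_ba -> /andP[_ le_ib]]].
  split=> //; rewrite (ltnW lt_ib) andbT (ltn_trans lt_ib) //.
  by rewrite (ltn_lift i (s b) (s a)).
by split=> //; rewrite ltn_neqAle neq_bump.
Qed.

End FirstEntry.

(** * The generating polynomial as a sum over first entries *)

(** The recurrence holds permutation by permutation, but the matrices on its
    right-hand side are not matrices of variables: weights are needed with
    arbitrary values substituted for the variables. *)
Definition weight_at (R : comNzRingType) (n : nat) (t : R) (A B : 'M[R]_n)
    (p : 'S_n) : R :=
  t ^+ N1324 p
  * (\prod_(i < n) \prod_(j < n | (i <= j)%N) A i j ^+ xexp p i j)
  * (\prod_(i < n) \prod_(j < n | (j <= i)%N) B i j ^+ yexp p i j).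

Lemma PsubstE (R : comNzRingType) n (t : R) (A B : 'M[R]_n) :
  Psubst t A B = \sum_(p : 'S_n) weight_at t A B p.
Proof.
have sub_var v : mmap intr (valuation t A B) 'X_(enum_rank v) =
    match v with
    | inl (inl _) => t
    | inl (inr (i, j)) => A i j
    | inr (i, j) => B i j
    end.
  by rewrite mmapX mmap1U /valuation enum_rankK.
rewrite /Psubst /P raddf_sum; apply: eq_bigr => p _.
rewrite /= /weight /tvar !rmorphM rmorphXn /= sub_var !rmorph_prod.
congr (_ * _ * _); apply: eq_bigr => i _; rewrite rmorph_prod /=.
  by apply: eq_bigr => j _; rewrite rmorphXn /Xvar mxE /= sub_var.
by apply: eq_bigr => j _; rewrite rmorphXn /Yvar mxE /= sub_var.
Qed.

(** The decomposition of a permutation into its first entry and the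
    standardization of the rest is injective, and [n.+1 * n`! = n.+1`!]. *)
Lemma sum_first_entry (V : nmodType) n (F : 'S_n.+1 -> V) :
  \sum_p F p = \sum_(i < n.+1) \sum_(s : 'S_n) F (lift_perm ord0 i s).
Proof.
rewrite pair_bigA; apply: reindex; apply: onW_bij.
apply: inj_card_bij; last by rewrite card_prod !card_Sn card_ord factS.
move=> [i s] [i' s'] /= eq_p.
have eq_i : i = i' by rewrite -(lift_perm_id ord0 i s) eq_p lift_perm_id.
rewrite -eq_i in eq_p *; congr (_, _); apply/permP => a.
by apply: (@lift_inj _ i); rewrite -!(lift_perm_lift ord0) eq_p.
Qed.

(** * The weight of a permutation with a prescribed first entry *)

Lemma prod_ord_lift (R : comNzRingType) n (i : 'I_n.+1) (Q : pred 'I_n.+1)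
    (F : 'I_n.+1 -> R) : ~~ Q i ->
  \prod_(k < n.+1 | Q k) F k =
  \prod_(r < n) if Q (lift i r) then F (lift i r) else 1.
Proof. by move=> /negPf Qi; rewrite big_mkcond (bigD1_ord i) //= Qi mul1r. Qed.

Section Recurrence.
Variables (R : comNzRingType) (n : nat) (t : R) (X Y : 'M[R]_n.+1).
Variables (i : 'I_n.+1) (s : 'S_n).
Local Notation p := (lift_perm ord0 i s).

Lemma X_row_first :
  \prod_(j < n.+1 | (i <= j)%N) X i j ^+ xexp p i j =
  \prod_(j < n.+1 | (i <= j < n)%N) X i j ^+ (n - j)%N.
Proof.
rewrite (bigID (fun j : 'I_n.+1 => (j < n)%N)) /= [X in _ * X]big1 ?mulr1.
  by apply: eq_bigr => j /andP[le_ij _]; rewrite xexp_first.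
move=> j /andP[le_ij]; rewrite -leqNgt => le_nj.
by rewrite xexp_first // (eqP (_ : n - j == 0)%N) ?subn_eq0.
Qed.

(** The row [lift i r] of [X] contributes the same power product to both sides,
    since merged columns carry equal exponents. The factors of [Y] in the merged
    column are the share that the 1 of value [lift i r] has in the 213 patterns
    starting at the first entry. *)
Lemma R2_row (r : 'I_n) :
  \prod_(c < n | (r <= c)%N) R2 X Y i r c ^+ xexp s r c =
  (\prod_(j < n.+1 | (lift i r <= j)%N) X (lift i r) j ^+ xexp p (lift i r) j)
  * (if (lift i r < i)%N
     then (\prod_(l < n.+1 | (l <= lift i r)%N) Y i l) ^+ xexp p (lift i r) i
     else 1).
Proof.
set k := lift i r.
have col (c : 'I_n) : (c.+1 == i :> nat) = false ->
    R2 X Y i r c ^+ xexp s r c = X k (lift i c) ^+ xexp p k (lift i c).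
  by move=> nci; rewrite mxE nci xexp_same.
case: ifPn => lt_ki; last first.
  rewrite -leqNgt in lt_ki.
  have lt_ik : (i < k)%N by rewrite ltn_neqAle neq_bump.
  (* Column i lies left of the diagonal, and so do the merged columns. *)
  rewrite mulr1 [RHS]big_mkcond (bigD1_ord i) //= leqNgt lt_ik mul1r.
  rewrite -big_mkcond /=.
  apply: eq_big => [c|c le_rc]; first by rewrite leq_lift.
  by apply: col; move: lt_ik; rewrite /k /= /bump; case: leqP; lia.
have i_gt0 : (0 < i)%N by exact: leq_ltn_trans lt_ki.
have lt_in : (i.-1 < n)%N by rewrite prednK // -ltnS.
pose c0 := Ordinal lt_in.
have c0i : c0.+1 = i :> nat by rewrite /= prednK.
have le_rc0 : (r <= c0)%N.
  by move: lt_ki; rewrite /= /bump; case: leqP; lia.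
rewrite (bigD1_ord i) /=; last exact: ltnW.
have merged : R2 X Y i r c0 =
    (\prod_(l < n.+1 | (l <= k)%N) Y i l) * X k (lift i c0) * X k i.
  by rewrite mxE /= prednK // eqxx (lt_ki : (bump i r < i)%N).
rewrite (bigD1 c0) //= merged.
rewrite (@xexp_merge _ _ _ _ c0) // [X in _ = _ * X * _](bigD1 c0) /=; last first.
  by rewrite (leq_lift i r c0).
rewrite xexp_same !exprMn -!mulrA.
have -> : \prod_(c < n | (r <= c)%N && (c != c0)) R2 X Y i r c ^+ xexp s r c =
  \prod_(c < n | (k <= bump i c)%N && (c != c0))
    X k (lift i c) ^+ xexp p k (lift i c).
  apply: eq_big => [c|c /andP[_ ncc0]]; first by rewrite (leq_lift i r c).
  by apply: col; rewrite -c0i eqSS; exact: negbTE.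
ring.
Qed.

(** The factor [t] in the merged column counts the 213 patterns with all entries
    above [i], which the first entry completes to 1324. *)
Lemma R1_row (r : 'I_n) :
  \prod_(c < n | (c <= r)%N) R1 t Y i r c ^+ yexp s r c =
  (\prod_(j < n.+1 | (j <= lift i r)%N) Y (lift i r) j ^+ yexp p (lift i r) j)
  * (if (i < lift i r)%N then t ^+ yexp p (lift i r) i else 1).
Proof.
set k := lift i r.
have col (c : 'I_n) : (c == i :> nat) = false ->
    R1 t Y i r c ^+ yexp s r c = Y k (lift i c) ^+ yexp p k (lift i c).
  by move=> nci; rewrite mxE nci yexp_same.
case: ifPn => lt_ik; last first.
  rewrite -leqNgt in lt_ik.
  have lt_ki : (k < i)%N by rewrite ltn_neqAle eq_sym neq_bump.
  (* Column i lies right of the diagonal, and so do the merged columns. *)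
  rewrite mulr1 [RHS]big_mkcond (bigD1_ord i) //= leqNgt lt_ki mul1r.
  rewrite -big_mkcond /=.
  apply: eq_big => [c|c le_cr]; first by rewrite (leq_lift i c r).
  by apply: col; move: lt_ki; rewrite /k /= /bump; case: leqP; lia.
have lt_in : (i < n)%N by apply: leq_trans lt_ik _; rewrite -ltnS.
pose c0 := Ordinal lt_in.
have le_c0r : (c0 <= r)%N.
  by move: lt_ik; rewrite /= /bump; case: leqP; lia.
rewrite (bigD1_ord i) /=; last exact: ltnW.
have merged : R1 t Y i r c0 = t * Y k i * Y k (lift i c0).
  by rewrite mxE /= eqxx.
rewrite (bigD1 c0) //= merged.
rewrite (@yexp_merge _ _ _ _ c0) // [X in _ = _ * X * _](bigD1 c0) /=; last first.
  by rewrite (leq_lift i c0 r).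
rewrite yexp_same !exprMn -!mulrA.
have -> : \prod_(c < n | (c <= r)%N && (c != c0)) R1 t Y i r c ^+ yexp s r c =
  \prod_(c < n | (bump i c <= k)%N && (c != c0))
    Y k (lift i c) ^+ yexp p k (lift i c).
  apply: eq_big => [c|c /andP[_ ncc0]]; first by rewrite (leq_lift i c r).
  by apply: col; exact: negbTE.
ring.
Qed.

(** Row [i] of [Y] has no counterpart in [R1 t Y i]; exchanging the products
    regroups it by the value [k] of the 1, which is the form in which the merged
    column of [R2] carries it. *)
Lemma Y_row_first :
  \prod_(j < n.+1 | (j <= i)%N) Y i j ^+ yexp p i j =
  \prod_(k < n.+1 | (k < i)%N)
    (\prod_(l < n.+1 | (l <= k)%N) Y i l) ^+ xexp p k i.
Proof.
under eq_bigr => j _ do rewrite yexp_first -prodrXr.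
rewrite (exchange_big_dep (fun k : 'I_n.+1 => (k < i)%N)) /=; last first.
  by move=> j k _ /andP[].
apply: eq_bigr => k lt_ki; rewrite -prodrXl; apply: eq_bigl => j.
by rewrite lt_ki andbT andb_idl // => le_jk; exact: leq_trans (ltnW lt_ki).
Qed.

Lemma weight_at_first :
  weight_at t X Y p =
  (\prod_(j < n.+1 | (i <= j < n)%N) X i j ^+ (n - j)%N)
  * weight_at t (R2 X Y i) (R1 t Y i) s.
Proof.
rewrite /weight_at [X in _ = _ * (_ * X * _)](eq_bigr _ (fun r _ => R2_row r)).
rewrite [X in _ = _ * (_ * X)](eq_bigr _ (fun r _ => R1_row r)) !big_split /=.
rewrite [X in _ * X * _ = _](bigD1_ord i) //= X_row_first.
rewrite [X in _ * X = _](bigD1_ord i) //= Y_row_first.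
rewrite N1324_first exprD -prodrXr.
have /= -> := prod_ord_lift (Q := fun k : 'I_n.+1 => (i < k)%N) _ (negbT (ltnn i)).
have /= -> := prod_ord_lift (Q := fun k : 'I_n.+1 => (k < i)%N) _ (negbT (ltnn i)).
ring.
Qed.

End Recurrence.

Theorem theorem1 (n : nat) :
  P n.+1 =
  \sum_(i < n.+1)
    (\prod_(j < n.+1 | (i <= j < n)%N) Xvar n.+1 i j ^+ (n - j)%N)
    * Psubst (tvar n.+1)
        (R2 (Xvar n.+1) (Yvar n.+1) i)
        (R1 (tvar n.+1) (Yvar n.+1) i).
Proof.
rewrite /P sum_first_entry; apply: eq_bigr => i _.
rewrite PsubstE mulr_sumr; apply: eq_bigr => s _.
exact: weight_at_first.
Qed.
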